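(* Let $p>-1$ be real, let $(a_k)_{k\ge 0}$ be a sequence of complex numbers and let $A\in\mathbb{C}$. The series $\sum_{k=0}^{\infty}a_k$ is $(C,p)$ summable with $(C,p)$ sum equal to $A$ if and only if both of the following conditions hold: $$ \lim_{x\to 1-0}\sum_{k=0}^{\infty}a_kx^k=A $$ and $$ \lim_{n\to\infty}\frac{S_{p+1}(f;n)}{n^{p+1}}=0, $$ where $f(x)=\sum_{j=0}^{\infty}a_jx^j$ and $S_{p+1}(f;n)=\sum_{k=1}^{n}k\,a_k\binom{n-k+p}{n-k}$.
   Context: For real $p>-1$ and an integer $m\ge 0$, $\binom{m+p}{m}=\frac{(p+1)(p+2)\cdots(p+m)}{m!}$ (equal to $1$ for $m=0$), i.e. the coefficient of $z^m$ in $(1-z)^{-(p+1)}$. The Cesàro means with parameter $p$ of a formal series $\sum_{k\ge0}a_k$ are $$\frac{1}{\binom{n+p}{n}}\sum_{k=0}^{n}a_k\binom{n-k+p}{n-k},\qquad n\ge 0.$$ The series is called $(C,p)$ summable with $(C,p)$ (Cesàro) sum $A$ if these means converge to $A$ as $n\to\infty$. The first condition (limit as $x\to1$ from below) is understood to include the convergence of $\sum_{k\ge 0} a_kx^k$ for $0\le x<1$. *)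

(* Defs.v *)
From Stdlib Require Import Reals Factorial.
From Coquelicot Require Import Coquelicot.
Open Scope R_scope.

Fixpoint rising (p : R) (m : nat) : R :=
  match m with
  | O => 1
  | S m' => rising p m' * (p + INR (S m'))
  end.

(* The binomial coefficient (m + p choose m) = (p+1)(p+2)...(p+m) / m!
   for a real parameter p. *)
Definition rbinom (p : R) (m : nat) : R := rising p m / INR (fact m).

Definition cesaro_mean (p : R) (a : nat -> C) (n : nat) : C :=
  (sum_n (fun k => a k * RtoC (rbinom p (n - k)))%C n / RtoC (rbinom p n))%C.

Definition cesaro_summable_to (p : R) (a : nat -> C) (A : C) : Prop :=
  filterlim (cesaro_mean p a) eventually (locally A).

(* Coquelicot has no sum operator for complex series, so the sum function f of
   the power series on [0, 1) is given through its graph; this includes the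
   convergence of the power series there. *)
Definition abel_summable_to (a : nat -> C) (A : C) : Prop :=
  exists f : R -> C,
    (forall x : R, 0 <= x < 1 -> is_pseries a (RtoC x) (f x)) /\
    filterlim f (at_left 1) (locally A).

(* S_{p+1}(f; n) for f with Taylor coefficients a: the first argument is p,
   not p + 1. *)
Definition S_succ (p : R) (a : nat -> C) (n : nat) : C :=
  sum_n_m (fun k => RtoC (INR k) * a k * RtoC (rbinom p (n - k)))%C 1 n.

(* Main.v *)
Require Import Defs.
From Stdlib Require Import Reals.
From Stdlib Require Import Factorial Lra Lia.
From Coquelicot Require Import Coquelicot.
Open Scope R_scope.

(* Write b_n^q = binom(n+q, n), sigma_n for the (C,p) means, tau_n for the
   (C,p+1) means and d_n = S_{p+1}(f;n) / b_n^{p+1}.  Comparing coefficients gives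
   sigma_n = tau_n + d_n/(p+1) and tau_n - tau_{n-1} = d_n/n, and b_n^{p+1} is
   comparable with n^{p+1}, so the second condition says d_n -> 0.  Moreover
   f(x) = (sum_n tau_n b_n^{p+1} x^n) / (sum_n b_n^{p+1} x^n) is a weighted mean
   of the tau_n.
   If sigma_n -> A then tau_n -> A, because tau_n is a weighted mean of the
   sigma_k; hence d_n -> 0 and f(x) -> A.  Conversely, if d_n -> 0, a direct
   estimate of the weighted mean as in Tauber's theorem yields
   f(1 - 1/(2n)) - tau_n -> 0, so tau_n -> A and sigma_n -> A. *)

(** * Binomial coefficients with a real parameter *)

Lemma rbinom_0 (p : R) : rbinom p 0 = 1.
Proof. unfold rbinom; simpl; field. Qed.

Lemma rbinom_S (p : R) (n : nat) :
  INR (S n) * rbinom p (S n) = (p + INR (S n)) * rbinom p n.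
Proof.
  unfold rbinom. rewrite fact_simpl, mult_INR. cbn [rising].
  assert (INR (fact n) <> 0) by apply INR_fact_neq_0.
  assert (INR (S n) <> 0) by (apply not_0_INR; lia).
  field; auto.
Qed.

(** The first-order recurrence and its initial value determine the sequence, so other expressions
    can be identified with binomials without unfolding factorials. *)
Lemma rbinom_unique (p : R) (c : nat -> R) :
  c 0%nat = 1 ->
  (forall n, INR (S n) * c (S n) = (p + INR (S n)) * c n) ->
  forall n, c n = rbinom p n.
Proof.
  intros H0 HS n. induction n as [|n IH].
  - now rewrite rbinom_0.
  - apply Rmult_eq_reg_l with (INR (S n)); [|apply not_0_INR; lia].
    now rewrite HS, rbinom_S, IH.
Qed.

Lemma rbinom_pos (p : R) (n : nat) : -1 < p -> 0 < rbinom p n.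
Proof.
  intros Hp. unfold rbinom. apply Rdiv_lt_0_compat; [|apply INR_fact_lt_0].
  induction n as [|n IH]; cbn [rising]; [lra|].
  apply Rmult_lt_0_compat; [exact IH|].
  rewrite S_INR. assert (0 <= INR n) by apply pos_INR. lra.
Qed.

(** Both sides equal (p+1)(p+2)...(p+1+n)/n!. This identity absorbs a linear factor into the next
    parameter and is what links the means with parameters p and p+1. *)
Lemma rbinom_raise (p : R) (n : nat) :
  (p + 1) * rbinom (p + 1) n = (p + 1 + INR n) * rbinom p n.
Proof.
  induction n as [|n IH].
  - rewrite !rbinom_0; simpl; ring.
  - assert (HS : INR (S n) <> 0) by (apply not_0_INR; lia).
    apply Rmult_eq_reg_l with (INR (S n)); [|exact HS].
    transitivity ((p + 1) * (INR (S n) * rbinom (p + 1) (S n))); [ring|].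
    rewrite rbinom_S.
    transitivity ((p + 1 + INR (S n)) * (INR (S n) * rbinom p (S n))); [|ring].
    rewrite rbinom_S.
    transitivity ((p + 1 + INR (S n)) * ((p + 1) * rbinom (p + 1) n)); [ring|].
    rewrite IH, S_INR. ring.
Qed.

(** Coefficient form of differentiating (1-z)^(-(p+1)). *)
Lemma rbinom_absorb (p : R) (n : nat) :
  INR (S n) * rbinom p (S n) = (p + 1) * rbinom (p + 1) n.
Proof. rewrite rbinom_S, rbinom_raise, S_INR. ring. Qed.

(** Coefficient form of (1-z) (1-z)^(-(p+2)) = (1-z)^(-(p+1)). *)
Lemma rbinom_pascal (p : R) (n : nat) :
  rbinom (p + 1) (S n) = rbinom (p + 1) n + rbinom p (S n).
Proof.
  apply Rmult_eq_reg_l with (INR (S n)); [|apply not_0_INR; lia].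
  rewrite Rmult_plus_distr_l, (rbinom_absorb p), rbinom_S. ring.
Qed.

Lemma sum_rbinom (p : R) (n : nat) :
  sum_f_R0 (rbinom p) n = rbinom (p + 1) n.
Proof.
  induction n as [|n IH]; simpl.
  - now rewrite !rbinom_0.
  - now rewrite IH, rbinom_pascal.
Qed.

Lemma rbinom_zero_l (n : nat) : rbinom 0 n = 1.
Proof.
  symmetry. apply (rbinom_unique 0 (fun _ => 1)); [reflexivity|intros; ring].
Qed.

(** The factor p + 1 vanishes at p = -1 and the recurrence propagates the zero. The generating
    function is the constant 1, the unit for convolution. *)
Lemma rbinom_m1_S (n : nat) : rbinom (-1) (S n) = 0.
Proof.
  induction n as [|n IH].
  - apply Rmult_eq_reg_l with (INR 1); [|simpl; lra].
    rewrite rbinom_S. simpl. ring.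
  - apply Rmult_eq_reg_l with (INR (S (S n))); [|apply not_0_INR; lia].
    rewrite rbinom_S, IH. ring.
Qed.

Lemma rbinom_ge_1 (p : R) (n : nat) : 0 <= p -> 1 <= rbinom p n.
Proof.
  intros Hp. induction n as [|n IH]; [rewrite rbinom_0; lra|].
  assert (Hn : 0 < INR (S n)) by (apply lt_0_INR; lia).
  apply Rmult_le_reg_l with (INR (S n)); [exact Hn|].
  rewrite rbinom_S.
  apply Rmult_le_compat; lra.
Qed.

(** Gives control for arbitrary negative parameters, where the coefficients may change sign or
    vanish. *)
Lemma rbinom_abs_le (p : R) (n : nat) : Rabs (rbinom p n) <= rbinom (Rabs p) n.
Proof.
  induction n as [|n IH]; [rewrite !rbinom_0, Rabs_R1; lra|].
  assert (Hn : 0 < INR (S n)) by (apply lt_0_INR; lia).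
  apply Rmult_le_reg_l with (INR (S n)); [exact Hn|].
  rewrite rbinom_S. rewrite <- (Rabs_pos_eq (INR (S n))) at 1 by lra.
  rewrite <- Rabs_mult, rbinom_S, Rabs_mult.
  apply Rmult_le_compat; try apply Rabs_pos; [|exact IH].
  eapply Rle_trans; [apply Rabs_triang|]. rewrite (Rabs_pos_eq (INR (S n))); lra.
Qed.

(** * Convolution of coefficient sequences *)

(** Vandermonde's identity, from (1-z)^(-(p+1)) (1-z)^(-(q+1)) = (1-z)^(-(p+q+2)). The convolution
    satisfies the recurrence of [rbinom_unique]: splitting n+1 as k + (n+1-k) plays the part of the
    product rule, and each half is lowered by [rbinom_S]. *)
Lemma PS_mult_rbinom (p q : R) (n : nat) :
  PS_mult (rbinom p) (rbinom q) n = rbinom (p + q + 1) n.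
Proof.
  revert n. apply rbinom_unique.
  - unfold PS_mult; simpl. rewrite !rbinom_0; ring.
  - intros n. unfold PS_mult.
    assert (Hl : sum_f_R0 (fun k => INR k * rbinom p k * rbinom q (S n - k)) (S n)
                 = sum_f_R0 (fun k => (p + INR (S k)) * rbinom p k * rbinom q (n - k)) n).
    { rewrite decomp_sum by lia. simpl (INR 0). rewrite !Rmult_0_l, Rplus_0_l.
      simpl pred. apply sum_eq. intros k Hk. rewrite rbinom_S.
      now replace (S n - S k)%nat with (n - k)%nat by lia. }
    assert (Hr : sum_f_R0 (fun k => INR (S n - k) * rbinom p k * rbinom q (S n - k)) (S n)
                 = sum_f_R0 (fun k => (q + INR (S n - k)) * rbinom p k * rbinom q (n - k)) n).
    { rewrite tech5, Nat.sub_diag. simpl (INR 0). rewrite !Rmult_0_l, Rplus_0_r.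
      apply sum_eq. intros k Hk.
      replace (S n - k)%nat with (S (n - k)) by lia.
      rewrite (Rmult_assoc (INR _)), (Rmult_comm (rbinom p k)), <- Rmult_assoc.
      rewrite rbinom_S. ring. }
    rewrite scal_sum.
    transitivity (sum_f_R0 (fun k => INR k * rbinom p k * rbinom q (S n - k)) (S n)
      + sum_f_R0 (fun k => INR (S n - k) * rbinom p k * rbinom q (S n - k)) (S n)).
    + rewrite <- sum_plus. apply sum_eq. intros k Hk.
      rewrite (minus_INR (S n) k) by lia. ring.
    + rewrite Hl, Hr, <- sum_plus, scal_sum. apply sum_eq. intros k Hk.
      rewrite (minus_INR (S n) k) by lia. rewrite !S_INR. ring.
Qed.

Lemma PS_mult_assoc (a b c : nat -> R) (n : nat) :
  PS_mult (PS_mult a b) c n = PS_mult a (PS_mult b c) n.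
Proof.
  (* Exchange of summation over the triangle of pairs (j, i) with j + i at most n. *)
  assert (tri : forall F : nat -> nat -> R,
    sum_f_R0 (fun k => sum_f_R0 (fun j => F j (k - j)%nat) k) n
    = sum_f_R0 (fun j => sum_f_R0 (fun i => F j i) (n - j)) n).
  { intros F. induction n as [|m IH]; [reflexivity|].
    rewrite tech5, IH, (tech5 (fun j => sum_f_R0 (fun i => F j i) (S m - j)) m).
    rewrite (tech5 (fun j => F j (S m - j)%nat)), Nat.sub_diag.
    rewrite <- Rplus_assoc, <- sum_plus. simpl (sum_f_R0 _ 0). f_equal.
    apply sum_eq. intros j Hj. now replace (S m - j)%nat with (S (m - j)) by lia. }
  unfold PS_mult.
  transitivity (sum_f_R0 (fun k => sum_f_R0 (fun j =>
      a j * b (k - j)%nat * c (n - j - (k - j))%nat) k) n).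
  - apply sum_eq. intros k Hk. rewrite Rmult_comm, scal_sum.
    apply sum_eq. intros j Hj. f_equal. f_equal. lia.
  - rewrite (tri (fun j i => a j * b i * c (n - j - i)%nat)).
    apply sum_eq. intros j Hj. rewrite scal_sum.
    apply sum_eq. intros i Hi. ring.
Qed.

(** * Growth of the binomial coefficients *)

(** Both bounds are ln u <= u - 1, taken at u = x/(x+1) and at u = (x+1)/x. *)
Lemma ln_succ_sub (x : R) : 0 < x -> / (x + 1) <= ln (x + 1) - ln x <= / x.
Proof.
  intros Hx. rewrite <- ln_div by lra. split.
  - replace ((x + 1) / x) with (/ (1 - / (x + 1))) by (field; lra).
    assert (H : 0 < / (x + 1) < 1).
    { split; [apply Rinv_0_lt_compat; lra|].
      rewrite <- Rinv_1. apply Rinv_lt_contravar; lra. }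
    rewrite ln_Rinv by lra.
    assert (He := exp_ineq1_le (ln (1 - / (x + 1)))). rewrite exp_ln in He; lra.
  - replace ((x + 1) / x) with (1 + / x) by (field; lra).
    assert (H : 0 < / x) by now apply Rinv_0_lt_compat.
    assert (He := exp_ineq1_le (ln (1 + / x))). rewrite exp_ln in He; lra.
Qed.

(** Equality holds at n = 1; afterwards the ratio 1 + q/(n+1) of consecutive binomials is at most
    ((n+1)/n)^q. *)
Lemma rbinom_le_Rpower (q : R) (n : nat) : 0 <= q -> (0 < n)%nat ->
  rbinom q n <= (q + 1) * Rpower (INR n) q.
Proof.
  intros Hq Hn. induction Hn as [|n Hn IH].
  - assert (H := rbinom_S q 0). rewrite rbinom_0 in H. simpl in H.
    unfold Rpower. simpl. rewrite ln_1, Rmult_0_r, exp_0. lra.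
  - assert (Hn0 : 0 < INR n) by (apply lt_0_INR; lia).
    apply Rmult_le_reg_l with (INR (S n)); [apply lt_0_INR; lia|].
    rewrite rbinom_S. unfold Rpower in *. rewrite S_INR.
    destruct (ln_succ_sub (INR n) Hn0) as [Hl _].
    assert (Hs : 1 + q / (INR n + 1) <= exp (q * (ln (INR n + 1) - ln (INR n)))).
    { eapply Rle_trans; [|apply exp_ineq1_le].
      apply Rplus_le_compat_l, Rmult_le_compat_l; lra. }
    replace (q * ln (INR n + 1)) with (q * (ln (INR n + 1) - ln (INR n)) + q * ln (INR n))
      by ring.
    rewrite exp_plus.
    replace (q + (INR n + 1)) with ((INR n + 1) * (1 + q / (INR n + 1))) by (field; lra).
    rewrite Rmult_assoc. apply Rmult_le_compat_l; [lra|].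
    rewrite (Rmult_comm (q + 1)), Rmult_assoc, (Rmult_comm _ (q + 1)).
    assert (0 < rbinom q n) by (apply rbinom_pos; lra).
    assert (0 <= q / (INR n + 1)) by (apply Rdiv_le_0_compat; lra).
    apply Rmult_le_compat; lra.
Qed.

Lemma Rpower_le_rbinom (q : R) (n : nat) : 0 <= q -> (0 < n)%nat ->
  Rpower (INR n) q <= Rpower (q + 1) q * rbinom q n.
Proof.
  intros Hq Hn.
  (* Shifting the base to y = n + q + 1 lets the induction start at n = 0 with equality, and its
     step becomes ((y+1)/y)^q <= exp(q/y) <= 1/(1 - q/y) = y/(n+1). *)
  apply Rle_trans with (Rpower (INR n + q + 1) q).
  { assert (0 < INR n) by (apply lt_0_INR; lia). apply Rle_Rpower_l; lra. }
  clear Hn. induction n as [|n IH].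
  - rewrite rbinom_0. simpl. rewrite Rplus_0_l. lra.
  - assert (Hn0 : 0 <= INR n) by apply pos_INR.
    apply Rmult_le_reg_l with (INR (S n)); [apply lt_0_INR; lia|].
    rewrite (Rmult_comm (Rpower (q + 1) q)), <- Rmult_assoc, rbinom_S.
    unfold Rpower in *. rewrite S_INR.
    destruct (ln_succ_sub (INR n + q + 1)) as [_ Hl]; [lra|].
    set (y := INR n + q + 1) in *.
    replace (INR n + 1 + q + 1) with (y + 1) by (unfold y; ring).
    assert (Hs : exp (q * (ln (y + 1) - ln y)) <= y / (INR n + 1)).
    { assert (Hy : q * (ln (y + 1) - ln y) <= q / y) by (apply Rmult_le_compat_l; lra).
      apply Rle_trans with (exp (q / y)).
      { destruct Hy as [Hy| ->]; [now apply Rlt_le, exp_increasing|apply Rle_refl]. }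
      assert (He := exp_ineq1_le (- (q / y))). rewrite exp_Ropp in He.
      replace (1 + - (q / y)) with ((INR n + 1) / y) in He
        by (unfold y; field; unfold y in *; lra).
      replace (y / (INR n + 1)) with (/ ((INR n + 1) / y)) by (field; unfold y; lra).
      rewrite <- (Rinv_inv (exp _)). apply Rinv_le_contravar; [|exact He].
      apply Rdiv_lt_0_compat; unfold y; lra. }
    replace (q * ln (y + 1)) with (q * (ln (y + 1) - ln y) + q * ln y) by ring.
    rewrite exp_plus.
    replace (q + (INR n + 1)) with ((INR n + 1) * (y / (INR n + 1)))
      by (unfold y; field; lra).
    rewrite !Rmult_assoc. apply Rmult_le_compat_l; [lra|].
    rewrite (Rmult_comm (rbinom q n)).
    apply Rmult_le_compat; try apply Rlt_le, exp_pos; assumption.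
Qed.

(** The partial sums are binomials with parameter p+1 > 0, which grow like n^(p+1). Divergence of
    the weights is what the weighted Cesàro theorem requires. *)
Lemma cv_infty_sum_rbinom (p : R) : -1 < p ->
  cv_infty (fun n => sum_f_R0 (rbinom p) n).
Proof.
  intros Hp M.
  assert (HK : 0 < Rpower (p + 1 + 1) (p + 1)) by apply exp_pos.
  set (K := Rpower (p + 1 + 1) (p + 1)) in *.
  (* [M] may be negative; the maximum with 1 gives a positive base for [Rpower]. *)
  set (M' := Rmax 1 (K * M)).
  assert (HM : 0 < M') by (apply Rlt_le_trans with 1; [lra|apply Rmax_l]).
  destruct (INR_unbounded (Rpower M' (/ (p + 1)))) as [N HN].
  exists N. intros n Hn. rewrite sum_rbinom.
  apply Rmult_lt_reg_l with K; [exact HK|].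
  assert (H0 : 0 < Rpower M' (/ (p + 1))) by apply exp_pos.
  assert (HNn : INR N <= INR n) by now apply le_INR.
  eapply Rlt_le_trans; [|apply Rpower_le_rbinom; [lra|]].
  - apply Rle_lt_trans with M'; [apply Rmax_r|].
    rewrite <- (Rpower_1 M') at 1 by exact HM.
    replace 1 with (/ (p + 1) * (p + 1)) at 1 by (field; lra).
    rewrite <- Rpower_mult. apply Rlt_Rpower_l; lra.
  - apply INR_lt. simpl. lra.
Qed.

(** * Power series with binomial weights *)

Lemma CV_radius_dominated (K : R) (a b : nat -> R) :
  (forall n, Rabs (a n) <= K * Rabs (b n)) ->
  Rbar_le (CV_radius b) (CV_radius a).
Proof.
  intros H. destruct (CV_radius_bounded a) as [ub _].
  destruct (CV_radius_bounded b) as [_ least].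
  apply least. intros r [M HM]. apply ub. exists (Rabs K * M). intros n.
  rewrite Rabs_mult.
  apply Rle_trans with (Rabs K * Rabs (b n * r ^ n)).
  - rewrite Rabs_mult, <- Rmult_assoc. apply Rmult_le_compat_r; [apply Rabs_pos|].
    eapply Rle_trans; [apply H|]. apply Rmult_le_compat_r; [apply Rabs_pos|].
    apply Rle_abs.
  - apply Rmult_le_compat_l; [apply Rabs_pos|apply HM].
Qed.

(** Were the radius r below 1, the series would converge at (r+1)/2, outside the disk, where its
    terms cannot tend to 0. *)
Lemma CV_radius_ge_1 (a : nat -> R) :
  (forall x, 0 <= x < 1 -> ex_pseries a x) -> Rbar_le 1 (CV_radius a).
Proof.
  intros H. apply Rbar_not_lt_le. intros Hlt.
  assert (H0 := CV_radius_ge_0 a).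
  destruct (CV_radius a) as [r| |] eqn:Er; simpl in Hlt, H0; try tauto.
  set (x := (r + 1) / 2).
  assert (Hx : Rabs x = x) by (apply Rabs_pos_eq; unfold x; lra).
  apply (CV_disk_outside a x).
  - rewrite Er, Hx. simpl. unfold x; lra.
  - apply ex_series_lim_0. apply ex_pseries_R. apply H. unfold x; lra.
Qed.

Lemma CV_radius_inside_1 (a : nat -> R) (x : R) :
  Rbar_le 1 (CV_radius a) -> 0 <= x < 1 -> Rbar_lt (Rabs x) (CV_radius a).
Proof.
  intros Ha Hx. apply Rbar_lt_le_trans with 1; [|exact Ha].
  rewrite Rabs_pos_eq; simpl; lra.
Qed.

(** The ratio test needs nonzero coefficients, so it is applied to the parameter |q|; domination by
    that series covers every real q. *)
Lemma CV_radius_rbinom (q : R) : Rbar_le 1 (CV_radius (rbinom q)).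
Proof.
  apply Rbar_le_trans with (CV_radius (rbinom (Rabs q))).
  - assert (Hq := Rabs_pos q). set (r := Rabs q) in *.
    replace (CV_radius (rbinom r)) with (Finite (/ 1)); [rewrite Rinv_1; apply Rbar_le_refl|].
    symmetry.
    apply CV_radius_finite_DAlembert.
    + intros n. apply Rgt_not_eq, rbinom_pos; lra.
    + lra.
    + apply is_lim_seq_ext with (fun n => 1 + r * / INR (S n)).
      * intros n.
        assert (HS : 0 < INR (S n)) by (apply lt_0_INR; lia).
        assert (Hb : 0 < rbinom r n) by (apply rbinom_pos; lra).
        assert (Hb' : 0 < rbinom r (S n)) by (apply rbinom_pos; lra).
        rewrite Rabs_pos_eq by (apply Rlt_le, Rdiv_lt_0_compat; assumption).
        apply Rmult_eq_reg_l with (INR (S n) * rbinom r n);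
          [|apply Rmult_integral_contrapositive; lra].
        transitivity (INR (S n) * rbinom r (S n)); [rewrite rbinom_S|]; field; lra.
      * replace (Finite 1) with (Rbar_plus 1 (Rbar_mult r 0))
          by (simpl; f_equal; ring).
        apply is_lim_seq_plus'; [apply is_lim_seq_const|].
        apply is_lim_seq_mult'; [apply is_lim_seq_const|].
        apply is_lim_seq_inv with (l := p_infty); [|discriminate].
        apply -> is_lim_seq_incr_1. apply is_lim_seq_INR.
  - apply CV_radius_dominated with 1. intros n.
    rewrite (Rabs_pos_eq (rbinom (Rabs q) n)).
    + rewrite Rmult_1_l. apply rbinom_abs_le.
    + apply Rlt_le, rbinom_pos. generalize (Rabs_pos q); lra.
Qed.

(** Raising the parameter by one is multiplication by the geometric series, whose coefficients are
    [rbinom 0]. *)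
Lemma PSeries_rbinom_raise (q x : R) : 0 <= x < 1 ->
  PSeries (rbinom (q + 1)) x = PSeries (rbinom q) x / (1 - x).
Proof.
  intros Hx.
  rewrite (PSeries_ext _ (PS_mult (rbinom q) (rbinom 0))).
  - rewrite PSeries_mult by (apply CV_radius_inside_1; [apply CV_radius_rbinom|lra]).
    unfold Rdiv. f_equal. rewrite (PSeries_ext _ (fun _ => 1)) by apply rbinom_zero_l.
    unfold PSeries. rewrite (Series_ext _ (fun n => x ^ n)) by (intros; ring).
    apply Series_geom. rewrite Rabs_pos_eq; lra.
  - intros n. rewrite PS_mult_rbinom. f_equal; ring.
Qed.

Lemma is_series_finite (u : nat -> R) (N : nat) :
  (forall n, (N < n)%nat -> u n = 0) -> is_series u (sum_f_R0 u N).
Proof.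
  intros H. unfold is_series.
  apply filterlim_ext_loc with (fun _ : nat => sum_f_R0 u N); [|apply filterlim_const].
  exists N. intros n Hn. rewrite sum_n_Reals.
  induction Hn as [|n Hn IH]; [reflexivity|].
  rewrite tech5, <- IH, H by lia. ring.
Qed.

Lemma sum_le_Series (u : nat -> R) (N : nat) :
  (forall n, 0 <= u n) -> ex_series u -> sum_f_R0 u N <= Series u.
Proof.
  intros Hu Hex. apply sum_incr; [|exact Hu].
  apply is_lim_seq_Reals. apply Series_correct in Hex.
  apply is_lim_seq_ext with (2 := Hex). intros n. apply sum_n_Reals.
Qed.

Lemma Series_abs_le (u v : nat -> R) (l : R) :
  (forall n, Rabs (u n) <= v n) -> is_series v l -> Rabs (Series u) <= l.
Proof.
  intros H Hv. rewrite <- (is_series_unique _ _ Hv).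
  assert (He : ex_series v) by now exists l.
  eapply Rle_trans.
  - apply Series_Rabs. apply (ex_series_le (fun n => Rabs (u n)) v); [|exact He].
    intros n. unfold norm; simpl. unfold abs; simpl. rewrite Rabs_Rabsolu. apply H.
  - apply Series_le; [|exact He]. intros n. split; [apply Rabs_pos|apply H].
Qed.

Lemma ex_series_rbinom (q x : R) : 0 <= x < 1 ->
  ex_series (fun n => rbinom q n * x ^ n).
Proof.
  intros Hx. apply ex_pseries_R, CV_radius_inside, CV_radius_inside_1;
    [apply CV_radius_rbinom|exact Hx].
Qed.

Lemma PSeries_rbinom_ge (q x : R) : 0 <= q -> 0 <= x < 1 ->
  / (1 - x) <= PSeries (rbinom q) x.
Proof.
  intros Hq Hx. rewrite <- Series_geom by (rewrite Rabs_pos_eq; lra).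
  apply Series_le; [|now apply ex_series_rbinom].
  intros n. assert (Hp : 0 <= x ^ n) by (apply pow_le; lra).
  split; [exact Hp|]. rewrite <- (Rmult_1_l (x ^ n)) at 1.
  apply Rmult_le_compat_r; [exact Hp|now apply rbinom_ge_1].
Qed.

Lemma bernoulli_le (h : R) (n : nat) : 0 <= h <= 1 -> 1 - INR n * h <= (1 - h) ^ n.
Proof.
  intros Hh. induction n as [|n IH]; [simpl; lra|].
  rewrite <- tech_pow_Rmult, S_INR.
  assert (Hp : 0 <= INR n) by apply pos_INR.
  apply Rle_trans with ((1 - h) * (1 - INR n * h)).
  - assert (0 <= INR n * (h * h)) by (apply Rmult_le_pos; [lra|apply Rmult_le_pos; lra]).
    nra.
  - apply Rmult_le_compat_l; lra.
Qed.

(** Keep the terms up to N, bound x^n below by x^N, and sum the weights. *)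
Lemma PSeries_rbinom_ge_pow (q x : R) (N : nat) : 0 <= q -> 0 <= x < 1 ->
  x ^ N * rbinom (q + 1) N <= PSeries (rbinom q) x.
Proof.
  intros Hq Hx. rewrite <- sum_rbinom, scal_sum.
  eapply Rle_trans; [|apply sum_le_Series with (N := N)].
  - apply sum_Rle. intros n Hn. apply Rmult_le_compat_l.
    + apply Rlt_le, rbinom_pos; lra.
    + replace N with (n + (N - n))%nat by lia. rewrite pow_add.
      rewrite <- (Rmult_1_r (x ^ n)) at 2. apply Rmult_le_compat_l; [apply pow_le; lra|].
      rewrite <- (pow1 (N - n)). apply pow_incr; lra.
  - intros n. apply Rmult_le_pos; [apply Rlt_le, rbinom_pos; lra|apply pow_le; lra].
  - now apply ex_series_rbinom.
Qed.

Lemma is_lim_seq_0_dominated (K : R) (u v : nat -> R) :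
  eventually (fun n => Rabs (u n) <= K * Rabs (v n)) ->
  is_lim_seq v 0 -> is_lim_seq u 0.
Proof.
  intros H Hv. apply is_lim_seq_abs_0.
  apply is_lim_seq_le_le_loc with (fun _ => 0) (fun n => K * Rabs (v n)).
  - apply filter_imp with (2 := H). intros n Hn. split; [apply Rabs_pos|exact Hn].
  - apply is_lim_seq_const.
  - replace (Finite 0) with (Rbar_mult K 0) by (simpl; f_equal; ring).
    apply is_lim_seq_mult'; [apply is_lim_seq_const|now apply -> is_lim_seq_abs_0].
Qed.

Lemma is_lim_seq_eps (u : nat -> R) (l : R) :
  is_lim_seq u l <-> forall eps, 0 < eps ->
    exists N, forall n, (N <= n)%nat -> Rabs (u n - l) < eps.
Proof. rewrite is_lim_seq_Reals. split; intros H; exact H. Qed.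

Lemma cesaro_rbinom (p : R) (u : nat -> R) (l : R) : -1 < p ->
  is_lim_seq u l ->
  is_lim_seq (fun n => sum_f_R0 (fun k => rbinom p k * u k) n / rbinom (p + 1) n) l.
Proof.
  intros Hp Hu. apply is_lim_seq_Reals in Hu. apply is_lim_seq_Reals.
  assert (Hpos : forall n, 0 < rbinom p n) by (intros n; now apply rbinom_pos).
  generalize (Cesaro (rbinom p) u l Hu Hpos (cv_infty_sum_rbinom p Hp)).
  rewrite <- !is_lim_seq_Reals. apply is_lim_seq_ext. intros n. now rewrite sum_rbinom.
Qed.

(** * Abelian and Tauberian theorems for binomially weighted means *)

Section BinomialMean.
Context (q : R) (tau : nat -> R) (Hq : 0 <= q)
  (Htau : Rbar_le 1 (CV_radius (fun n => rbinom q n * tau n))).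

Lemma PSeries_binomial_minus (c x : R) : 0 <= x < 1 ->
  PSeries (fun n => rbinom q n * tau n) x - c * PSeries (rbinom q) x
  = Series (fun n => rbinom q n * (tau n - c) * x ^ n).
Proof.
  intros Hx. unfold PSeries. rewrite <- Series_scal_l, <- Series_minus.
  - apply Series_ext. intros n. ring.
  - apply ex_pseries_R, CV_radius_inside, CV_radius_inside_1; assumption.
  - exact (ex_series_scal_l c _ (ex_series_rbinom q x Hx)).
Qed.

Lemma binomial_mean_minus (c x : R) : 0 <= x < 1 ->
  Rabs (PSeries (fun n => rbinom q n * tau n) x / PSeries (rbinom q) x - c)
  = Rabs (Series (fun n => rbinom q n * (tau n - c) * x ^ n)) / PSeries (rbinom q) x.
Proof.
  intros Hx.
  assert (HB : 0 < PSeries (rbinom q) x).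
  { eapply Rlt_le_trans; [|now apply PSeries_rbinom_ge]. apply Rinv_0_lt_compat; lra. }
  rewrite <- PSeries_binomial_minus by exact Hx.
  rewrite <- (Rabs_pos_eq (PSeries (rbinom q) x)) at 3 by lra.
  rewrite <- Rabs_div by lra. f_equal. field; lra.
Qed.

(** Split at an index N beyond which tau is within eps/2 of A. The tail contributes at most eps/2 to
    the mean; the head is bounded while the denominator is at least 1/(1-x). *)
Lemma abelian_mean (A : R) : is_lim_seq tau A ->
  filterlim (fun x => PSeries (fun n => rbinom q n * tau n) x / PSeries (rbinom q) x)
    (at_left 1) (locally A).
Proof.
  intros Hlim. apply filterlim_locally. intros eps.
  apply is_lim_seq_eps with (eps := eps / 2) in Hlim; [|generalize (cond_pos eps); lra].
  destruct Hlim as [N HN].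
  (* Majorant of the head, with x^n bounded by 1, so that its sum [L] does not depend on x. *)
  set (l := fun n => if Nat.leb n N then rbinom q n * Rabs (tau n - A) else 0).
  assert (Hl : forall n, 0 <= l n).
  { intros n. unfold l. destruct (Nat.leb n N); [|lra].
    apply Rmult_le_pos; [apply Rlt_le, rbinom_pos; lra|apply Rabs_pos]. }
  set (L := sum_f_R0 l N).
  assert (HL : 0 <= L) by (apply cond_pos_sum, Hl).
  (* The head costs at most L(1-x), hence less than eps/2; [L + 1] avoids dividing by zero when [L]
     is 0. *)
  assert (Hd : 0 < eps / (2 * (L + 1))).
  { apply Rdiv_lt_0_compat; [apply cond_pos|lra]. }
  assert (Hd' : 0 < Rmin 1 (eps / (2 * (L + 1)))) by (apply Rmin_pos; lra).
  exists (mkposreal _ Hd'). intros x Hball Hx1.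
  assert (Hx : 1 - x < Rmin 1 (eps / (2 * (L + 1)))).
  { change (Rabs (x - 1) < Rmin 1 (eps / (2 * (L + 1)))) in Hball.
    rewrite <- Rabs_Ropp, Rabs_pos_eq in Hball; lra. }
  assert (Hm1 := Rmin_l 1 (eps / (2 * (L + 1)))).
  assert (Hm2 := Rmin_r 1 (eps / (2 * (L + 1)))).
  assert (Hx01 : 0 <= x < 1) by lra.
  change (Rabs (PSeries (fun n => rbinom q n * tau n) x / PSeries (rbinom q) x - A) < eps).
  rewrite binomial_mean_minus by exact Hx01.
  assert (HB := PSeries_rbinom_ge q x Hq Hx01).
  assert (HB0 : 0 < PSeries (rbinom q) x).
  { eapply Rlt_le_trans; [|exact HB]. apply Rinv_0_lt_compat; lra. }
  assert (Hser : is_series (fun n => l n + eps / 2 * (rbinom q n * x ^ n))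
                   (L + eps / 2 * PSeries (rbinom q) x)).
  { apply (is_series_plus l).
    - apply is_series_finite. intros n Hn. unfold l.
      now rewrite (proj2 (Nat.leb_gt n N)) by exact Hn.
    - exact (is_series_scal (eps / 2 : R_AbsRing) _ _
        (Series_correct _ (ex_series_rbinom q x Hx01))). }
  apply Rle_lt_trans with ((L + eps / 2 * PSeries (rbinom q) x) / PSeries (rbinom q) x).
  - apply Rmult_le_compat_r; [apply Rlt_le, Rinv_0_lt_compat, HB0|].
    apply Series_abs_le with (2 := Hser). intros n.
    assert (Hb : 0 < rbinom q n) by (apply rbinom_pos; lra).
    assert (Hp : 0 <= x ^ n) by (apply pow_le; lra).
    assert (Hp1 : x ^ n <= 1) by (rewrite <- (pow1 n); apply pow_incr; lra).
    rewrite !Rabs_mult, (Rabs_pos_eq (rbinom q n)), (Rabs_pos_eq (x ^ n)) by lra.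
    assert (He := cond_pos eps).
    assert (Ha := Rabs_pos (tau n - A)).
    assert (Hba : 0 <= rbinom q n * Rabs (tau n - A)) by (apply Rmult_le_pos; lra).
    assert (Hbx : 0 <= rbinom q n * x ^ n) by (apply Rmult_le_pos; lra).
    unfold l. destruct (Nat.leb_spec n N) as [Hn|Hn].
    + assert (0 <= eps / 2 * (rbinom q n * x ^ n)) by (apply Rmult_le_pos; lra).
      nra.
    + assert (Rabs (tau n - A) < eps / 2) by (apply HN; lia). nra.
  - unfold Rdiv at 1. rewrite Rmult_plus_distr_r, Rmult_assoc, Rinv_r, Rmult_1_r by lra.
    assert (/ PSeries (rbinom q) x <= 1 - x).
    { rewrite <- (Rinv_inv (1 - x)). apply Rinv_le_contravar; [|exact HB].
      apply Rinv_0_lt_compat; lra. }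
    assert (L * / PSeries (rbinom q) x <= L * (1 - x)) by (apply Rmult_le_compat_l; lra).
    assert (L * (1 - x) <= (L + 1) * (1 - x)) by (apply Rmult_le_compat_r; lra).
    assert ((L + 1) * (1 - x) < (L + 1) * (eps / (2 * (L + 1))))
      by (apply Rmult_lt_compat_l; lra).
    replace ((L + 1) * (eps / (2 * (L + 1)))) with (eps / 2) in * by (field; lra).
    lra.
Qed.

Context (d : nat -> R)
  (Hd : forall n, tau (S n) - tau n = d (S n) / INR (S n)).

(** Cumulative bound on the variation of [tau]. Only differences of [D] occur, so the term at k = 0,
    a division by zero, cancels. *)
Let D := sum_f_R0 (fun k => Rabs (d k) / INR k).

Lemma variation_le (n m : nat) : (n <= m)%nat -> Rabs (tau m - tau n) <= D m - D n.
Proof.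
  intros H. induction H as [|m H IH].
  - rewrite Rminus_diag, Rabs_R0. lra.
  - replace (tau (S m) - tau n) with ((tau (S m) - tau m) + (tau m - tau n)) by ring.
    eapply Rle_trans; [apply Rabs_triang|]. unfold D at 1. rewrite tech5. fold (D m).
    rewrite Hd, Rabs_div by (apply not_0_INR; lia).
    rewrite (Rabs_pos_eq (INR (S m))) by apply pos_INR. lra.
Qed.

(** Each of the m - N increments is at most e/N. Weakening m - N to m gives a bound linear in m,
    which [is_series_INR_rbinom] sums in closed form. *)
Lemma variation_small (e : R) (N m : nat) : 0 <= e -> (0 < N <= m)%nat ->
  (forall k, (N <= k)%nat -> Rabs (d k) <= e) ->
  Rabs (tau m - tau N) <= e / INR N * INR m.
Proof.
  intros He [HN H] Hde. assert (HN' : 0 < INR N) by (apply lt_0_INR; lia).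
  apply Rle_trans with (e / INR N * (INR m - INR N)).
  - induction H as [|m H IH].
    + rewrite !Rminus_diag, Rabs_R0. lra.
    + replace (tau (S m) - tau N) with ((tau (S m) - tau m) + (tau m - tau N)) by ring.
      eapply Rle_trans; [apply Rabs_triang|].
      rewrite Hd, Rabs_div by (apply not_0_INR; lia).
      rewrite (Rabs_pos_eq (INR (S m))) by apply pos_INR.
      assert (Rabs (d (S m)) / INR (S m) <= e / INR N).
      { apply Rmult_le_compat; [apply Rabs_pos| |apply Hde; lia|].
        - apply Rlt_le, Rinv_0_lt_compat, lt_0_INR; lia.
        - apply Rinv_le_contravar; [exact HN'|]. apply le_INR; lia. }
      apply Rle_trans with (e / INR N + e / INR N * (INR m - INR N)); [lra|].
      rewrite S_INR. lra.
  - apply Rmult_le_compat_l; [|lra]. apply Rdiv_le_0_compat; lra.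
Qed.

(** Exchanging sums, |d_k|/k receives the total weight of the indices below k, namely binom(k-1+q+1,
    k-1), and [rbinom_absorb] turns this over k into binom(k+q, k)/(q+1). The induction on N adds
    one such k at a time. *)
Lemma weighted_variation_le (N : nat) :
  sum_f_R0 (fun n => rbinom q n * (D N - D n)) N
  <= sum_f_R0 (fun k => rbinom q k * Rabs (d k)) N / (q + 1).
Proof.
  induction N as [|N IH].
  - simpl. rewrite rbinom_0. generalize (Rabs_pos (d 0%nat)); intros.
    replace (1 * _) with 0 by ring. apply Rdiv_le_0_compat; lra.
  - rewrite tech5, Rminus_diag, Rmult_0_r, Rplus_0_r.
    replace (sum_f_R0 (fun n => rbinom q n * (D (S N) - D n)) N) with
      (sum_f_R0 (fun n => rbinom q n * (D N - D n)) N
       + sum_f_R0 (fun n => rbinom q n * (Rabs (d (S N)) / INR (S N))) N).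
    + rewrite tech5, <- scal_sum, sum_rbinom, Rdiv_plus_distr.
      apply Rplus_le_compat; [exact IH|]. apply Req_le.
      assert (HS : INR (S N) <> 0) by (apply not_0_INR; lia).
      apply Rmult_eq_reg_r with (INR (S N) * (q + 1));
        [|apply Rmult_integral_contrapositive; split; [exact HS|lra]].
      transitivity (Rabs (d (S N)) * ((q + 1) * rbinom (q + 1) N)); [field; auto|].
      rewrite <- rbinom_absorb. field; lra.
    + rewrite <- sum_plus. apply sum_eq. intros n Hn. unfold D at 3.
      rewrite tech5. fold (D N). ring.
Qed.

(** This is x times the derivative of (1-x)^(-(q+1)), obtained by shifting coefficients with
    [rbinom_absorb]. *)
Lemma is_series_INR_rbinom (x : R) : 0 <= x < 1 ->
  is_series (fun n => INR n * (rbinom q n * x ^ n))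
    ((q + 1) * x * PSeries (rbinom (q + 1)) x).
Proof.
  intros Hx.
  replace ((q + 1) * x * PSeries (rbinom (q + 1)) x) with
    (PSeries (PS_incr_1 (PS_scal (q + 1) (rbinom (q + 1)))) x)
    by (rewrite PSeries_incr_1, PSeries_scal; ring).
  apply is_series_ext with
    (fun n => PS_incr_1 (PS_scal (q + 1) (rbinom (q + 1))) n * x ^ n).
  - intros [|n].
    + simpl. unfold zero; simpl. ring.
    + rewrite <- Rmult_assoc, rbinom_absorb. reflexivity.
  - apply Series_correct, ex_pseries_R, ex_pseries_incr_1, ex_pseries_scal.
    + apply Rmult_comm.
    + apply CV_radius_inside, CV_radius_inside_1; [apply CV_radius_rbinom|exact Hx].
Qed.

(* The choice [x = 1 - 1 / (2 N)] keeps [x ^ N] away from 0 and makes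
   [1 / (1 - x)] comparable with [N]. *)
Lemma tauberian_mean : is_lim_seq d 0 ->
  is_lim_seq (fun N =>
    PSeries (fun n => rbinom q n * tau n) (1 - / (2 * INR N))
      / PSeries (rbinom q) (1 - / (2 * INR N)) - tau N) 0.
Proof.
  intros Hlim.
  (* This quantity will bound the terms n <= N: it is a weighted Cesàro mean of |d_k|, hence tends
     to 0. *)
  assert (HC : is_lim_seq (fun N =>
     2 / (q + 1) * (sum_f_R0 (fun k => rbinom q k * Rabs (d k)) N / rbinom (q + 1) N)) 0).
  { replace (Finite 0) with (Rbar_mult (2 / (q + 1)) 0) by (simpl; f_equal; ring).
    apply is_lim_seq_mult'; [apply is_lim_seq_const|].
    apply cesaro_rbinom; [lra|]. now apply -> is_lim_seq_abs_0. }
  apply is_lim_seq_eps. intros eps Heps.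
  apply is_lim_seq_eps with (eps := eps / 2) in HC; [|lra]. destruct HC as [N1 HN1].
  (* The terms n > N will contribute 2e(q+1)x, which this choice of e makes equal to (eps/2)x. *)
  assert (He : 0 < eps / (4 * (q + 1))) by (apply Rdiv_lt_0_compat; lra).
  apply is_lim_seq_eps with (2 := He) in Hlim. destruct Hlim as [N2 HN2].
  set (e := eps / (4 * (q + 1))) in *.
  exists (S (N1 + N2)). intros N HN.
  assert (HN0 : 1 <= INR N) by (apply (le_INR 1); lia).
  specialize (HN1 N ltac:(lia)). rewrite Rminus_0_r in *. apply Rabs_def2 in HN1.
  destruct HN1 as [HN1 _].
  assert (Hde : forall k, (N <= k)%nat -> Rabs (d k) <= e).
  { intros k Hk. specialize (HN2 k ltac:(lia)). rewrite Rminus_0_r in HN2. lra. }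
  assert (Hh : 0 < / (2 * INR N) <= 1 / 2).
  { split; [apply Rinv_0_lt_compat; lra|].
    replace (1 / 2) with (/ 2) by lra. apply Rinv_le_contravar; lra. }
  assert (Hhe : 1 - (1 - / (2 * INR N)) = / (2 * INR N)) by ring.
  set (x := 1 - / (2 * INR N)) in *.
  assert (Hx : 0 <= x < 1) by lra.
  assert (HxN : 1 / 2 <= x ^ N).
  { apply Rle_trans with (1 - INR N * / (2 * INR N)).
    - apply Req_le. field; lra.
    - apply bernoulli_le; lra. }
  rewrite binomial_mean_minus by exact Hx.
  set (B := PSeries (rbinom q) x).
  assert (Hb1 : 0 < rbinom (q + 1) N) by (apply rbinom_pos; lra).
  assert (HB : rbinom (q + 1) N / 2 <= B).
  { eapply Rle_trans; [|apply (PSeries_rbinom_ge_pow q x N); assumption]. nra. }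
  assert (HB0 : 0 < B) by lra.
  (* Terms with n <= N are bounded through [D], with x^n replaced by 1; later terms use
     [variation_small]. *)
  set (l := fun n => if Nat.leb n N then rbinom q n * (D N - D n) else 0).
  set (T := sum_f_R0 (fun k => rbinom q k * Rabs (d k)) N) in *.
  assert (HL : sum_f_R0 l N <= T / (q + 1)).
  { eapply Rle_trans; [|apply weighted_variation_le]. apply Req_le, sum_eq.
    intros n Hn. unfold l. now rewrite (proj2 (Nat.leb_le n N)). }
  assert (Hser : is_series (fun n => l n + e / INR N * (INR n * (rbinom q n * x ^ n)))
     (sum_f_R0 l N + e / INR N * ((q + 1) * x * PSeries (rbinom (q + 1)) x))).
  { apply (is_series_plus l).
    - apply is_series_finite. intros n Hn. unfold l.
      now rewrite (proj2 (Nat.leb_gt n N)) by exact Hn.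
    - exact (is_series_scal (e / INR N : R_AbsRing) _ _ (is_series_INR_rbinom x Hx)). }
  (* The series with parameter q+1 becomes B/(1-x) = 2NB: the factor N cancels the one in e/N, and B
     cancels the denominator of the mean. *)
  rewrite PSeries_rbinom_raise in Hser by exact Hx. fold B in Hser. rewrite Hhe in Hser.
  eapply Rle_lt_trans.
  { apply Rmult_le_compat_r; [apply Rlt_le, Rinv_0_lt_compat, HB0|].
    apply Series_abs_le with (2 := Hser). intros n.
    assert (Hb : 0 < rbinom q n) by (apply rbinom_pos; lra).
    assert (Hp : 0 <= x ^ n) by (apply pow_le; lra).
    assert (Hp1 : x ^ n <= 1) by (rewrite <- (pow1 n); apply pow_incr; lra).
    rewrite !Rabs_mult, (Rabs_pos_eq (rbinom q n)), (Rabs_pos_eq (x ^ n)) by lra.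
    assert (Ha := Rabs_pos (tau n - tau N)).
    assert (Hbx : 0 <= rbinom q n * x ^ n) by (apply Rmult_le_pos; lra).
    assert (HeN : 0 <= e / INR N * INR n).
    { apply Rmult_le_pos; [apply Rdiv_le_0_compat; lra|apply pos_INR]. }
    unfold l. destruct (Nat.leb_spec n N) as [Hn|Hn].
    - assert (Hv := variation_le n N Hn). rewrite Rabs_minus_sym in Hv.
      assert (rbinom q n * Rabs (tau n - tau N) * x ^ n <= rbinom q n * (D N - D n)).
      { rewrite <- (Rmult_1_r (rbinom q n * (D N - D n))).
        apply Rmult_le_compat; try lra.
        - apply Rmult_le_pos; lra.
        - apply Rmult_le_compat_l; lra. }
      assert (0 <= e / INR N * INR n * (rbinom q n * x ^ n)) by (apply Rmult_le_pos; lra).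
      lra.
    - assert (Hv := variation_small e N n ltac:(lra) ltac:(lia) Hde).
      assert (Rabs (tau n - tau N) * (rbinom q n * x ^ n)
              <= e / INR N * INR n * (rbinom q n * x ^ n))
        by (apply Rmult_le_compat_r; lra).
      lra. }
  replace ((sum_f_R0 l N + e / INR N * ((q + 1) * x * (B / / (2 * INR N)))) * / B)
    with (sum_f_R0 l N * / B + 2 * (e * (q + 1)) * x) by (field; lra).
  replace (e * (q + 1)) with (eps / 4) by (unfold e; field; lra).
  assert (HT : 0 <= T).
  { apply cond_pos_sum. intros n. apply Rmult_le_pos; [|apply Rabs_pos].
    apply Rlt_le, rbinom_pos; lra. }
  assert (sum_f_R0 l N * / B <= 2 / (q + 1) * (T / rbinom (q + 1) N)).
  { apply Rle_trans with (T / (q + 1) * / (rbinom (q + 1) N / 2)).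
    - apply Rle_trans with (T / (q + 1) * / B).
      + apply Rmult_le_compat_r; [apply Rlt_le, Rinv_0_lt_compat, HB0|exact HL].
      + apply Rmult_le_compat_l; [apply Rdiv_le_0_compat; lra|].
        apply Rinv_le_contravar; lra.
    - apply Req_le. field; lra. }
  nra.
Qed.

End BinomialMean.

(** * Real series *)

(** [PSeries] is total, with a default value at points of divergence, so convergence is demanded
    separately. *)
Definition abel_summable_to_R (a : nat -> R) (A : R) : Prop :=
  (forall x, 0 <= x < 1 -> ex_pseries a x) /\
  filterlim (PSeries a) (at_left 1) (locally A).

Lemma PS_mult_rbinom_step (p : R) (a : nat -> R) (n : nat) :
  PS_mult a (rbinom (p + 1)) (S n)
  = PS_mult a (rbinom (p + 1)) n + PS_mult a (rbinom p) (S n).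
Proof.
  unfold PS_mult. rewrite !tech5, Nat.sub_diag, !rbinom_0, <- Rplus_assoc.
  f_equal. rewrite <- sum_plus. apply sum_eq. intros k Hk.
  replace (S n - k)%nat with (S (n - k)) by lia. rewrite rbinom_pascal. ring.
Qed.

(** Termwise, write p+1+n as k + (p+1+(n-k)) and apply [rbinom_raise] to the second summand. *)
Lemma PS_mult_rbinom_raise (p : R) (a : nat -> R) (n : nat) :
  (p + 1 + INR n) * PS_mult a (rbinom p) n
  = PS_mult (fun k => INR k * a k) (rbinom p) n
    + (p + 1) * PS_mult a (rbinom (p + 1)) n.
Proof.
  unfold PS_mult. rewrite !scal_sum, <- sum_plus. apply sum_eq. intros k Hk.
  assert (H := rbinom_raise p (n - k)). rewrite minus_INR in H by exact Hk.
  transitivity (INR k * a k * rbinom p (n - k)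
    + a k * ((p + 1 + (INR n - INR k)) * rbinom p (n - k))); [ring|].
  rewrite <- H. ring.
Qed.

Lemma PS_mult_rbinom_m1 (a : nat -> R) (n : nat) : PS_mult a (rbinom (-1)) n = a n.
Proof.
  unfold PS_mult. destruct n as [|n].
  - simpl. rewrite rbinom_0; ring.
  - rewrite tech5, Nat.sub_diag, rbinom_0, Rmult_1_r.
    rewrite (sum_eq _ (fun _ => 0)).
    + rewrite sum_cte. ring.
    + intros k Hk. replace (S n - k)%nat with (S (n - k)) by lia.
      rewrite rbinom_m1_S. ring.
Qed.

Lemma sum_PS_mult_rbinom (p : R) (a : nat -> R) (n : nat) :
  sum_f_R0 (PS_mult a (rbinom p)) n = PS_mult a (rbinom (p + 1)) n.
Proof.
  induction n as [|n IH].
  - unfold PS_mult; simpl. now rewrite !rbinom_0.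
  - now rewrite tech5, IH, PS_mult_rbinom_step.
Qed.

Section RealSeries.
Context (p : R) (Hp : -1 < p) (a : nat -> R).

Let sigma n := PS_mult a (rbinom p) n / rbinom p n.
Let tau n := PS_mult a (rbinom (p + 1)) n / rbinom (p + 1) n.
Let d n := PS_mult (fun k => INR k * a k) (rbinom p) n / rbinom (p + 1) n.

Let Hb n : 0 < rbinom p n.
Proof. now apply rbinom_pos. Qed.

Let Hb1 n : 0 < rbinom (p + 1) n.
Proof. apply rbinom_pos; lra. Qed.

Lemma sigma_tau (n : nat) : sigma n = tau n + d n / (p + 1).
Proof.
  assert (Hn : 0 <= INR n) by apply pos_INR.
  specialize (Hb n); specialize (Hb1 n).
  assert (H1 := rbinom_raise p n). assert (H2 := PS_mult_rbinom_raise p a n).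
  unfold sigma, tau, d.
  apply Rmult_eq_reg_l with ((p + 1 + INR n) * rbinom p n);
    [|apply Rmult_integral_contrapositive; lra].
  transitivity ((p + 1 + INR n) * PS_mult a (rbinom p) n); [field; lra|].
  rewrite <- H1, H2. field; lra.
Qed.

(** Eliminating the parameter-p convolution between [PS_mult_rbinom_raise] and [PS_mult_rbinom_step]
    expresses the numerator of d by two consecutive numerators of tau; [rbinom_S] matches the
    denominators. *)
Lemma tau_step (n : nat) : tau (S n) - tau n = d (S n) / INR (S n).
Proof.
  assert (Hn : 0 < INR (S n)) by (apply lt_0_INR; lia).
  assert (H1 := rbinom_S (p + 1) n). assert (H2 := PS_mult_rbinom_raise p a (S n)).
  assert (H3 := PS_mult_rbinom_step p a n).
  assert (Hbn := Hb1 n). assert (HbS := Hb1 (S n)).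
  unfold tau, d.
  set (t := PS_mult a (rbinom (p + 1))) in *.
  assert (H4 : PS_mult (fun k => INR k * a k) (rbinom p) (S n)
    = INR (S n) * t (S n) - (p + 1 + INR (S n)) * t n) by (rewrite H3 in *; lra).
  rewrite H4. apply Rminus_diag_uniq.
  transitivity (t n * ((p + 1 + INR (S n)) / (INR (S n) * rbinom (p + 1) (S n))
     - / rbinom (p + 1) n)); [field; lra|].
  rewrite H1. field; lra.
Qed.

Lemma tau_term (n : nat) : rbinom (p + 1) n * tau n = PS_mult a (rbinom (p + 1)) n.
Proof. unfold tau. specialize (Hb1 n). field; lra. Qed.

Lemma CV_radius_tau : Rbar_le 1 (CV_radius a) ->
  Rbar_le 1 (CV_radius (fun n => rbinom (p + 1) n * tau n)).
Proof.
  intros Ha. apply CV_radius_ge_1. intros x Hx.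
  apply ex_pseries_ext with (PS_mult a (rbinom (p + 1))).
  - intros n. symmetry. apply tau_term.
  - apply ex_pseries_mult; apply CV_radius_inside_1; trivial; apply CV_radius_rbinom.
Qed.

Lemma PSeries_tau (x : R) : Rbar_le 1 (CV_radius a) -> 0 <= x < 1 ->
  PSeries (fun n => rbinom (p + 1) n * tau n) x / PSeries (rbinom (p + 1)) x
  = PSeries a x.
Proof.
  intros Ha Hx. rewrite (PSeries_ext _ _ _ tau_term).
  rewrite PSeries_mult
    by (apply CV_radius_inside_1; trivial; apply CV_radius_rbinom).
  assert (HB := PSeries_rbinom_ge (p + 1) x ltac:(lra) Hx).
  assert (0 < / (1 - x)) by (apply Rinv_0_lt_compat; lra). field; lra.
Qed.

Lemma d_lim_iff_Rpower : is_lim_seq d 0 <->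
  is_lim_seq (fun n => PS_mult (fun k => INR k * a k) (rbinom p) n
                       / Rpower (INR n) (p + 1)) 0.
Proof.
  assert (HR : forall n, 0 < Rpower (INR n) (p + 1)) by (intros; apply exp_pos).
  assert (mono : forall K u v w : R, 0 < v -> 0 < w -> w <= K * v ->
    Rabs (u / v) <= K * Rabs (u / w)).
  { intros K u v w Hv Hw H. rewrite !Rabs_div, (Rabs_pos_eq v), (Rabs_pos_eq w) by lra.
    apply Rmult_le_reg_r with (v * w); [now apply Rmult_lt_0_compat|].
    replace (Rabs u / v * (v * w)) with (Rabs u * w) by (field; lra).
    replace (K * (Rabs u / w) * (v * w)) with (Rabs u * (K * v)) by (field; lra).
    apply Rmult_le_compat_l; [apply Rabs_pos|exact H]. }
  split.
  - apply is_lim_seq_0_dominated with (K := p + 1 + 1).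
    (* The comparison with powers starts at n = 1; at 0 [Rpower] only has a default value. *)
    exists 1%nat. intros n Hn. apply mono; trivial.
    apply rbinom_le_Rpower; [lra|lia].
  - apply is_lim_seq_0_dominated with (K := Rpower (p + 1 + 1) (p + 1)).
    exists 1%nat. intros n Hn. apply mono; trivial.
    apply Rpower_le_rbinom; [lra|lia].
Qed.

Lemma cesaro_tauber (A : R) :
  is_lim_seq sigma A <-> abel_summable_to_R a A /\ is_lim_seq d 0.
Proof.
  split.
  - intros Hs.
    (* [tau] is the mean of [sigma] with weights [rbinom p], since these weights cancel the
       denominators of [sigma]. *)
    assert (Ht : is_lim_seq tau A).
    { apply is_lim_seq_ext with (2 := cesaro_rbinom p _ _ Hp Hs). intros n.
      unfold tau. rewrite <- sum_PS_mult_rbinom. f_equal. apply sum_eq.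
      intros k Hk. unfold sigma. specialize (Hb k). field; lra. }
    assert (Hd : is_lim_seq d 0).
    { apply is_lim_seq_ext with (fun n => (p + 1) * (sigma n - tau n)).
      - intros n. rewrite sigma_tau. field; lra.
      - replace (Finite 0) with (Rbar_mult (p + 1) (A - A)) by (simpl; f_equal; ring).
        apply is_lim_seq_mult'; [apply is_lim_seq_const|].
        now apply is_lim_seq_minus'. }
    assert (Ha : Rbar_le 1 (CV_radius a)).
    (* A convergent [tau] is bounded, so the coefficients of f(z)(1-z)^(-(p+2)) are dominated by
       binomials; convergence of f itself is then recovered by deconvolution. *)
    { destruct (maj_by_pos tau) as [M [_ HM]].
      { exists A. now apply is_lim_seq_Reals. }
      assert (Hr : Rbar_le 1 (CV_radius (PS_mult a (rbinom (p + 1))))).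
      { eapply Rbar_le_trans; [apply (CV_radius_rbinom (p + 1))|].
        apply CV_radius_dominated with M. intros n. rewrite <- tau_term, Rabs_mult, Rmult_comm.
        apply Rmult_le_compat_r; [apply Rabs_pos|apply HM]. }
      apply CV_radius_ge_1. intros x Hx.
      (* The binomials with parameter [-(p+1)-2] are the coefficients of
         [(1 - x)^(p+2)], which inverts the convolution. *)
      apply ex_pseries_ext with
        (PS_mult (PS_mult a (rbinom (p + 1))) (rbinom (- (p + 1) - 2))).
      - intros n. rewrite PS_mult_assoc, <- (PS_mult_rbinom_m1 a n).
        unfold PS_mult at 1 3. apply sum_eq. intros k Hk. f_equal.
        rewrite PS_mult_rbinom. f_equal. ring.
      - apply ex_pseries_mult; apply CV_radius_inside_1; trivial; apply CV_radius_rbinom. }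
    split; [split|exact Hd].
    + intros x Hx. now apply CV_radius_inside, CV_radius_inside_1.
    + apply filterlim_ext_loc with
        (2 := abelian_mean (p + 1) tau ltac:(lra) (CV_radius_tau Ha) A Ht).
      exists (mkposreal 1 Rlt_0_1). intros x Hball Hx1.
      apply PSeries_tau; [exact Ha|].
      change (Rabs (x - 1) < 1) in Hball. apply Rabs_def2 in Hball. lra.
  - intros [[Hex Hlim] Hd].
    assert (Ha := CV_radius_ge_1 a Hex).
    assert (HT := tauberian_mean (p + 1) tau ltac:(lra) (CV_radius_tau Ha) d tau_step Hd).
    assert (Hh : is_lim_seq (fun N => / (2 * INR N)) 0).
    { apply is_lim_seq_inv with (l := p_infty); [|discriminate].
      apply is_lim_seq_mult with (2 : R) p_infty; [apply is_lim_seq_const|apply is_lim_seq_INR|].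
      apply is_Rbar_mult_sym, is_Rbar_mult_p_infty_pos. simpl; lra. }
    (* The Abel limit is used only along these points, which lie strictly left of 1 once N >= 1. *)
    assert (Hx : filterlim (fun N => 1 - / (2 * INR N)) eventually (at_left 1)).
    { intros P [e He].
      apply is_lim_seq_eps with (eps := e) in Hh; [|apply cond_pos].
      destruct Hh as [N HN]. exists (S N). intros n Hn.
      assert (0 < / (2 * INR n)).
      { apply Rinv_0_lt_compat. assert (0 < INR n) by (apply lt_0_INR; lia). lra. }
      apply He; [|lra].
      change (Rabs (1 - / (2 * INR n) - 1) < e). rewrite <- Rabs_Ropp.
      replace (- (1 - / (2 * INR n) - 1)) with (/ (2 * INR n) - 0) by ring.
      apply HN; lia. }
    assert (Hf : is_lim_seq (fun N => PSeries a (1 - / (2 * INR N))) A)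
      by (eapply filterlim_comp; [exact Hx|exact Hlim]).
    assert (Ht : is_lim_seq tau A).
    { replace (Finite A) with (Finite (A - 0)) by (f_equal; ring).
      apply is_lim_seq_ext_loc with (2 := is_lim_seq_minus' _ _ _ _ Hf HT).
      exists 1%nat. intros n Hn.
      assert (1 <= INR n) by (apply (le_INR 1); lia).
      rewrite PSeries_tau; [ring|exact Ha|].
      assert (0 < / (2 * INR n)) by (apply Rinv_0_lt_compat; lra).
      assert (/ (2 * INR n) <= / 1) by (apply Rinv_le_contravar; lra). lra. }
    apply is_lim_seq_ext with (fun n => tau n + d n * / (p + 1)).
    { intros n. now rewrite sigma_tau. }
    replace (Finite A) with (Finite (A + 0 * / (p + 1))) by (f_equal; ring).
    apply is_lim_seq_plus'; [exact Ht|].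
    apply is_lim_seq_mult'; [exact Hd|apply is_lim_seq_const].
Qed.

End RealSeries.

(** * Complex series *)

(** The uniform structure on [C] is that of the product, so a ball is a pair of real balls. *)
Lemma filterlim_Re_Im {T : Type} (F : (T -> Prop) -> Prop) {FF : Filter F}
    (f : T -> C) (A : C) :
  filterlim f F (locally A) <->
  filterlim (fun t => Re (f t)) F (locally (Re A)) /\
  filterlim (fun t => Im (f t)) F (locally (Im A)).
Proof.
  rewrite !filterlim_locally. split.
  - intros H. split; intros eps; apply filter_imp with (2 := H eps); now intros t [H1 H2].
  - intros [H1 H2] eps. apply filter_imp with (2 := filter_and _ _ (H1 eps) (H2 eps)).
    intros t [K1 K2]. now split.
Qed.

Lemma sum_n_Re_Im (u : nat -> C) (n : nat) :
  sum_n u n = (sum_n (fun k => Re (u k)) n, sum_n (fun k => Im (u k)) n).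
Proof.
  induction n as [|n IH].
  - rewrite !sum_O. now destruct (u 0%nat).
  - rewrite !sum_Sn, IH. reflexivity.
Qed.

Lemma pow_n_RtoC (x : R) (n : nat) : pow_n (RtoC x) n = RtoC (pow_n x n).
Proof.
  induction n as [|n IH]; [reflexivity|]. simpl. rewrite IH.
  symmetry. apply RtoC_mult.
Qed.

Lemma is_pseries_Re_Im (a : nat -> C) (x : R) (l : C) :
  is_pseries a (RtoC x) l <->
  is_pseries (fun k => Re (a k)) x (Re l) /\ is_pseries (fun k => Im (a k)) x (Im l).
Proof.
  assert (Hsum : forall n, sum_n (fun k => scal (pow_n (RtoC x) k) (a k)) n
    = (sum_n (fun k => scal (pow_n x k) (Re (a k))) n,
       sum_n (fun k => scal (pow_n x k) (Im (a k))) n)).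
  { intros n. etransitivity; [apply sum_n_Re_Im|].
    f_equal; apply sum_n_ext; intros k; rewrite pow_n_RtoC;
      unfold scal, Re, Im; simpl; unfold mult; simpl; ring. }
  unfold is_pseries, is_series. rewrite filterlim_Re_Im by apply eventually_filter.
  split; intros [H1 H2]; (split; [eapply filterlim_ext, H1|eapply filterlim_ext, H2]);
    intros n; cbv beta; now rewrite Hsum.
Qed.

(** On [0, 1) uniqueness of sums forces the coordinates of f to be the two [PSeries]; as [0, 1) is a
    left neighbourhood of 1, the limits agree. *)
Lemma abel_summable_to_Re_Im (a : nat -> C) (A : C) :
  abel_summable_to a A <->
  abel_summable_to_R (fun k => Re (a k)) (Re A) /\
  abel_summable_to_R (fun k => Im (a k)) (Im A).
Proof.
  assert (Hnear : at_left 1 (fun x => 0 <= x < 1)).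
  { exists (mkposreal 1 Rlt_0_1). intros x Hball Hx1.
    change (Rabs (x - 1) < 1) in Hball. apply Rabs_def2 in Hball. lra. }
  split.
  - intros [f [Hf Hlim]]. apply filterlim_Re_Im in Hlim; [|apply at_left_proper_filter].
    destruct Hlim as [H1 H2].
    assert (Hf' := fun x Hx => proj1 (is_pseries_Re_Im a x (f x)) (Hf x Hx)).
    split; (split; [intros x Hx; destruct (Hf' x Hx); eexists; eassumption|]).
    + apply filterlim_ext_loc with (2 := H1). apply filter_imp with (2 := Hnear).
      intros x Hx. symmetry. apply is_pseries_unique, Hf', Hx.
    + apply filterlim_ext_loc with (2 := H2). apply filter_imp with (2 := Hnear).
      intros x Hx. symmetry. apply is_pseries_unique, Hf', Hx.
  - intros [[Hex1 H1] [Hex2 H2]].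
    exists (fun x => (PSeries (fun k => Re (a k)) x, PSeries (fun k => Im (a k)) x)).
    split.
    + intros x Hx. apply is_pseries_Re_Im.
      split; apply PSeries_correct; auto.
    + apply filterlim_Re_Im; [apply at_left_proper_filter|]. now split.
Qed.

Lemma Re_Im_div_RtoC (z : C) (r : R) : r <> 0 ->
  (z / RtoC r)%C = (Re z / r, Im z / r).
Proof.
  intros Hr. destruct z as [u v]. unfold Cdiv, Cinv, Cmult, Re, Im; simpl.
  f_equal; field; auto.
Qed.

Lemma sum_n_mult_rbinom (p : R) (a : nat -> C) (n : nat) :
  sum_n (fun k => a k * RtoC (rbinom p (n - k)))%C n
  = (PS_mult (fun k => Re (a k)) (rbinom p) n, PS_mult (fun k => Im (a k)) (rbinom p) n).
Proof.
  rewrite sum_n_Re_Im. unfold PS_mult. rewrite <- !sum_n_Reals.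
  f_equal; apply sum_n_ext; intros k; unfold Re, Im; simpl; ring.
Qed.

Lemma S_succ_eq (p : R) (a : nat -> C) (n : nat) :
  S_succ p a n
  = (PS_mult (fun k => INR k * Re (a k)) (rbinom p) n,
     PS_mult (fun k => INR k * Im (a k)) (rbinom p) n).
Proof.
  transitivity (sum_n (fun k => (RtoC (INR k) * a k) * RtoC (rbinom p (n - k)))%C n).
  (* The factor k kills the term at 0, so starting at 0 or at 1 makes no difference. *)
  - unfold S_succ, sum_n. rewrite (sum_Sn_m _ 0 n) by lia.
    simpl (INR 0). rewrite !Cmult_0_l. symmetry. exact (Cplus_0_l _).
  - rewrite sum_n_mult_rbinom. unfold PS_mult.
    f_equal; apply sum_eq; intros k Hk; unfold Re, Im; simpl; ring.
Qed.

Theorem theorem1p2 (p : R) (Hp : -1 < p) (a : nat -> C) (A : C) :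
  cesaro_summable_to p a A <->
  abel_summable_to a A /\
  filterlim (fun n : nat => (S_succ p a n / RtoC (Rpower (INR n) (p + 1)))%C)
    eventually (locally (RtoC 0)).
Proof.
  assert (HR := cesaro_tauber p Hp (fun k => Re (a k)) (Re A)).
  assert (HI := cesaro_tauber p Hp (fun k => Im (a k)) (Im A)).
  rewrite d_lim_iff_Rpower in HR, HI by exact Hp.
  assert (Hs : cesaro_summable_to p a A <->
    is_lim_seq (fun n => PS_mult (fun k => Re (a k)) (rbinom p) n / rbinom p n) (Re A) /\
    is_lim_seq (fun n => PS_mult (fun k => Im (a k)) (rbinom p) n / rbinom p n) (Im A)).
  { unfold cesaro_summable_to. rewrite filterlim_Re_Im by apply eventually_filter.
    assert (Hb : forall n, rbinom p n <> 0)
      by (intros n; apply Rgt_not_eq, rbinom_pos, Hp).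
    split; intros [H1 H2]; (split; [eapply filterlim_ext, H1|eapply filterlim_ext, H2]);
      intros n; unfold cesaro_mean; cbv beta; rewrite Re_Im_div_RtoC, sum_n_mult_rbinom by apply Hb;
      reflexivity. }
  assert (HS : filterlim (fun n : nat => (S_succ p a n / RtoC (Rpower (INR n) (p + 1)))%C)
      eventually (locally (RtoC 0)) <->
    is_lim_seq (fun n => PS_mult (fun k => INR k * Re (a k)) (rbinom p) n
                         / Rpower (INR n) (p + 1)) 0 /\
    is_lim_seq (fun n => PS_mult (fun k => INR k * Im (a k)) (rbinom p) n
                         / Rpower (INR n) (p + 1)) 0).
  { rewrite filterlim_Re_Im by apply eventually_filter.
    (* [Rpower] is an exponential, hence nonzero even at n = 0, and the division splits into
       coordinates for every n. *)
    assert (Hb : forall n, Rpower (INR n) (p + 1) <> 0)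
      by (intros n; apply Rgt_not_eq, exp_pos).
    split; intros [H1 H2]; (split; [eapply filterlim_ext, H1|eapply filterlim_ext, H2]);
      intros n; cbv beta; rewrite Re_Im_div_RtoC, S_succ_eq by apply Hb; reflexivity. }
  rewrite Hs, HS, HR, HI, abel_summable_to_Re_Im. tauto.
Qed.
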